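(* Let $\mathcal E$ be the toric vector bundle over a complete toric variety $X_\Sigma$ determined by the data $(L,\Phi)$. The equivariant $K$-class and equivariant Chern classes of $\mathcal E$ coincide with those of its tropicalization $(\mathcal M(L),\Phi)$. In particular, all tropicalizations of $\mathcal E$ have the same equivariant $K$-classes and Chern classes.
   Context: $T$ is a torus with cocharacter lattice $N$ and character lattice $M$; $\Sigma$ is a complete fan in $N_{\mathbb R}$; $\mathbf v_\rho$ is the primitive generator of a ray $\rho$; $M_\sigma=M/(\sigma^\perp\cap M)$. For a loop-free matroid $\mathcal M$ of rank $r$ on $\{1,\dots,m\}$, $\operatorname{Berg}(\mathcal M)\subset\mathbb R^m$ is the set of $w$ such that for every circuit $C$ the minimum $\min_{i\in C}w_i$ is attained at least twice. For a basis $B$, the apartment $A_B$ is the set of $w\in\operatorname{Berg}(\mathcal M)$ for which $\sum_{b\in B}w_b$ is maximal among all bases; projection to the $B$-coordinates identifies $A_B$ with $\mathbb R^B\cong\mathbb R^r$. Data $(L,\Phi)$. Let $E$ be an $r$-dimensional $\Bbbk$-vector space with a spanning set of nonzero vectors $e_1,\dots,e_m$; $L\subset\Bbbk[x_1,\dots,x_m]$ is the ideal generated by the linear relations among the $e_i$, and $\mathcal M(L)$ is the linear matroid of $e_1,\dots,e_m$; $\operatorname{Trop}(L)=\operatorname{Berg}(\mathcal M(L))$. $\Phi:N_{\mathbb R}\to\operatorname{Trop}(L)$ is an integral ($\Phi(N)\subset\mathbb Z^m$) piecewise linear map: for each $\sigma\in\Sigma$ there is a basis $B_\sigma$ with $\Phi(\sigma)\subset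 A_{B_\sigma}$ and $\Phi|_\sigma$ linear in the coordinates $\mathbb R^{B_\sigma}$. The toric vector bundle determined by $(L,\Phi)$ is the one with fiber $E$ over the base point and Klyachko filtrations $E^\rho_k=\operatorname{span}\{e_i:\Phi(\mathbf v_\rho)_i\ge k\}$. Its tropicalization is the tropical toric vector bundle $(\mathcal M(L),\Phi)$. Classes of a toric vector bundle. For each $\sigma$ let $u(\sigma)\subset M_\sigma$ be the multiset of characters by which $T$ acts on the equivariantly trivial bundle $\mathcal E|_{U_\sigma}$, i.e. there is a decomposition $E=\bigoplus_{[u]\in u(\sigma)}L_{[u]}$ into lines with $E^\rho_k=\sum_{\langle u,\mathbf v_\rho\rangle\ge k}L_{[u]}$ for all rays $\rho$ of $\sigma$. The equivariant $K$-class of $\mathcal E$ is represented by the piecewise exponential function equal to $x\mapsto\sum_{[u]\in u(\sigma)}\exp\langle u,x\rangle$ on each maximal $\sigma$; the $i$-th equivariant Chern class by the piecewise polynomial function equal on each maximal $\sigma$ to the $i$-th elementary symmetric function of the linear functions $\langle u,\cdot\rangle$, $[u]\in u(\sigma)$. Classes of a tropical toric vector bundle $(\mathcal M,\Phi)$. Its equivariant $K$-class is the function $\exp_{\mathcal M}\circ\Phi$ and its $i$-th equivariant Chern class is $\epsilon_{\mathcal M,i}\circ\Phi$, where $\exp_{\mathcal M},\epsilon_{\mathcal M,i}:\operatorname{Berg}(\mathcal M)\to\mathbb R$ are the (well-defined) functions which on each apartment $A_B\cong\mathbb R^r$ equal $\sum_{j}\exp(x_j)$ and the $i$-th elementary symmetric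 function $\epsilon_i(x_1,\dots,x_r)$, respectively. *)

(* Defs.v *)
From HB Require Import structures.
From mathcomp Require Import all_boot all_order all_algebra.
From mathcomp Require Import all_classical all_reals all_analysis.

Set Implicit Arguments.
Unset Strict Implicit.
Unset Printing Implicit Defensive.

Import Order.TTheory GRing.Theory Num.Theory.

Local Open Scope classical_set_scope.
Local Open Scope ring_scope.

(* A basis of the cocharacter lattice is fixed once and for all: N and M are
   'rV[int]_n in dual bases and N_R is 'rV[R]_n. *)

Definition toR (R : realType) (n : nat) (v : 'rV[int]_n) : 'rV[R]_n :=
  map_mx intr v.

Definition pairing (R : realType) (n : nat) (u x : 'rV[R]_n) : R :=
  \sum_(a < n) u 0 a * x 0 a.

Definition cone (R : realType) (n : nat) (s : seq 'rV[int]_n) :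
    set 'rV[R]_n :=
  [set x | exists c : 'I_(size s) -> R, (forall i, 0 <= c i) /\
     x = \sum_(i < size s) c i *: toR R (s`_i)].
Arguments cone R {n} s.

Definition rational_polyhedral (R : realType) (n : nat)
    (sigma : set 'rV[R]_n) : Prop :=
  exists s : seq 'rV[int]_n, sigma = cone R s.

Definition strongly_convex (R : realType) (n : nat)
    (sigma : set 'rV[R]_n) : Prop :=
  forall x, sigma x -> sigma (- x) -> x = 0.

Definition is_face (R : realType) (n : nat) (tau sigma : set 'rV[R]_n) : Prop :=
  exists u : 'rV[R]_n, (forall x, sigma x -> 0 <= pairing u x) /\
    tau = [set x | sigma x /\ pairing u x = 0].

Record fan (R : realType) (n : nat) := Fan {
  cones : set (set 'rV[R]_n);
  fan_finite : finite_set cones;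
  fan_rational : forall sigma, cones sigma -> rational_polyhedral sigma;
  fan_strongly_convex : forall sigma, cones sigma -> strongly_convex sigma;
  fan_face : forall sigma tau, cones sigma -> is_face tau sigma -> cones tau;
  fan_meet : forall sigma tau, cones sigma -> cones tau ->
    is_face (sigma `&` tau) sigma /\ is_face (sigma `&` tau) tau
}.

Definition complete_fan (R : realType) (n : nat) (Sigma : fan R n) : Prop :=
  forall x : 'rV[R]_n, exists2 sigma, cones Sigma sigma & sigma x.

Definition maximal_cone (R : realType) (n : nat) (Sigma : fan R n)
    (sigma : set 'rV[R]_n) : Prop :=
  cones Sigma sigma /\
  forall tau, cones Sigma tau -> sigma `<=` tau -> tau = sigma.

(* In particular v <> 0, since 0 = 0 *: v'. *)
Definition primitive (n : nat) (v : 'rV[int]_n) : Prop :=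
  forall (d : int) (v' : 'rV[int]_n), v = d *: v' -> `|d|%N = 1%N.

(* A ray of the fan is given by its primitive generator. *)
Record ray (R : realType) (n : nat) (Sigma : fan R n) := Ray {
  ray_gen : 'rV[int]_n;
  ray_primitive : primitive ray_gen;
  ray_cone : cones Sigma (cone R [:: ray_gen])
}.

Definition ray_of (R : realType) (n : nat) (Sigma : fan R n)
    (sigma : set 'rV[R]_n) (rho : ray Sigma) : Prop :=
  is_face (cone R [:: ray_gen rho]) sigma.

Record matroid (m : nat) := Matroid {
  indep : {set {set 'I_m}};
  indep0 : finset.set0 \in indep;
  indepS : forall I J : {set 'I_m}, I \subset J -> J \in indep -> I \in indep;
  indep_augment : forall I J : {set 'I_m}, I \in indep -> J \in indep ->
    (#|I| < #|J|)%N -> exists2 j, j \in (J :\: I)%SET & (j |: I)%SET \in indep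
}.

Definition loop_free (m : nat) (M : matroid m) : Prop :=
  forall i : 'I_m, [set i]%SET \in indep M.

Definition is_basis (m : nat) (M : matroid m) (B : {set 'I_m}) : bool :=
  maxset (fun I => I \in indep M) B.

Definition is_circuit (m : nat) (M : matroid m) (C : {set 'I_m}) : bool :=
  minset (fun I => I \notin indep M) C.

Definition berg (R : realType) (m : nat) (M : matroid m) : set 'rV[R]_m :=
  [set w | forall C : {set 'I_m}, is_circuit M C ->
     exists i j : 'I_m, [/\ i \in C, j \in C, i != j, w 0 i = w 0 j &
       forall l, l \in C -> w 0 i <= w 0 l]].
Arguments berg R {m} M.

Definition apartment (R : realType) (m : nat) (M : matroid m)
    (B : {set 'I_m}) : set 'rV[R]_m :=
  [set w | berg R M w /\ forall B' : {set 'I_m}, is_basis M B' ->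
     \sum_(b in B') w 0 b <= \sum_(b in B) w 0 b].
Arguments apartment R {m} M B.

Definition elem_sym (R : realType) (I : finType) (B : {set I}) (x : I -> R)
    (i : nat) : R :=
  \sum_(A : {set I} | (A \subset B) && (#|A| == i)) \prod_(a in A) x a.

(* Some basis whose apartment contains w; the value is irrelevant outside the
   Bergman fan, and lemmas [exp_matroid_apartment] and
   [eps_matroid_apartment] show that the choice does not matter on it. *)
Definition basis_at (R : realType) (m : nat) (M : matroid m) (w : 'rV[R]_m) :
    {set 'I_m} :=
  odflt finset.set0 [pick B | is_basis M B && `[< apartment R M B w >]].

Definition exp_matroid (R : realType) (m : nat) (M : matroid m)
    (w : 'rV[R]_m) : R :=
  \sum_(b in basis_at M w) expR (w 0 b).

Definition eps_matroid (R : realType) (m : nat) (M : matroid m) (i : nat)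
    (w : 'rV[R]_m) : R :=
  elem_sym (basis_at M w) (fun b => w 0 b) i.

Lemma basis_indep (m : nat) (M : matroid m) (B : {set 'I_m}) :
  is_basis M B -> B \in indep M.
Proof. by case/maxsetP. Qed.

Lemma basis_max (m : nat) (M : matroid m) (B I : {set 'I_m}) :
  is_basis M B -> I \in indep M -> (#|I| <= #|B|)%N.
Proof.
move=> /maxsetP[iB maxB] iI; rewrite leqNgt; apply/negP => lt_BI.
have [j] := indep_augment iB iI lt_BI.
rewrite finset.in_setD => /andP[jNB _] ijB.
have jB := maxB _ ijB (finset.subsetUr _ _).
by move: jNB; rewrite -jB finset.setU11.
Qed.

Lemma basis_card (m : nat) (M : matroid m) (B I : {set 'I_m}) :
  is_basis M B -> I \in indep M -> (#|B| <= #|I|)%N -> is_basis M I.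
Proof.
move=> bB iI le_BI; apply/maxsetP; split=> // J iJ sIJ.
apply/esym/eqP; rewrite eqEcard sIJ.
exact: leq_trans (basis_max bB iJ) le_BI.
Qed.

Lemma indep_extend (m : nat) (M : matroid m) (B I : {set 'I_m}) :
  is_basis M B -> I \in indep M ->
  exists J, [/\ is_basis M J, I \subset J & J \subset (I :|: B)%SET].
Proof.
move=> bB; move: {2}(#|B| - #|I|)%N (leqnn (#|B| - #|I|)%N) => d.
elim: d I => [|d IHd] I le_d iI.
  exists I; split=> //; last exact: finset.subsetUl.
  by apply: (basis_card bB iI); rewrite -subn_eq0 -leqn0.
have [le_BI|lt_IB] := leqP #|B| #|I|.
  by exists I; split=> //; [exact: (basis_card bB)|exact: finset.subsetUl].
have [j] := indep_augment iI (basis_indep bB) lt_IB.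
rewrite finset.in_setD => /andP[jNI jB] ijI.
have [|J [bJ sJ1 sJ2]] := IHd (j |: I)%SET _ ijI.
  by rewrite cardsU1 jNI add1n subnS -ltnS prednK // subn_gt0.
exists J; split=> //.
  exact: fintype.subset_trans (finset.subsetUr _ _) sJ1.
apply: fintype.subset_trans sJ2 _.
by rewrite -finset.setUA finset.subUset fintype.subxx andbT finset.sub1set
  finset.in_setU jB orbT.
Qed.

(* All bases of maximal w-weight carry the same multiset of w-values. *)
Lemma apartment_count (R : realType) (m : nat) (M : matroid m)
    (w : 'rV[R]_m) (B B' : {set 'I_m}) (P : pred R) :
  (forall x y, P x -> ~~ P y -> y < x) ->
  is_basis M B -> is_basis M B' -> apartment R M B w ->
  (#|[set b in B' | P (w ord0 b)]%SET| <=
    #|[set b in B | P (w ord0 b)]%SET|)%N.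
Proof.
move=> upP bB bB' [_ maxB]; rewrite leqNgt; apply/negP => lt_BB'.
set I := [set b in B | _]%SET in lt_BB'.
set I' := [set b in B' | _]%SET in lt_BB'.
have sIB : I \subset B by apply/fintype.subsetP => b; rewrite inE => /andP[].
have iI : I \in indep M by apply: indepS sIB (basis_indep bB).
have iI' : I' \in indep M.
  apply: indepS (basis_indep bB').
  by apply/fintype.subsetP => b; rewrite inE => /andP[].
have [j] := indep_augment iI iI' lt_BB'.
rewrite !inE => /andP[jNI /andP[jB' Pj]] ijI.
have jNB : j \notin B by move: jNI; rewrite Pj andbT.
have [J [bJ sIJ sJ]] := indep_extend bB ijI.
have sJB : J \subset (j |: B)%SET.
  apply: fintype.subset_trans sJ _; apply/fintype.subsetP => b; rewrite !inE.
  by case: (b == j) => //=; case: (b \in B).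
have jJ : j \in J by apply: (fintype.subsetP sIJ); rewrite !inE eqxx.
have cJ : #|J| = #|B|.
  by apply/eqP; rewrite eqn_leq (basis_max bB (basis_indep bJ))
    (basis_max bJ (basis_indep bB)).
have sJjB : (J :\ j)%SET \subset B.
  apply/fintype.subsetP => b; rewrite !inE => /andP[bj bJJ].
  by have := fintype.subsetP sJB _ bJJ; rewrite !inE (negbTE bj).
have cD : #|(B :\: (J :\ j))%SET| = 1%N.
  have cJj : #|(J :\ j)%SET|.+1 = #|B| by rewrite -cJ (cardsD1 j J) jJ.
  by rewrite cardsD (finset.setIidPr sJjB) -cJj subSnn.
have /cards1P[c Dc] : #|(B :\: (J :\ j))%SET| == 1%N by rewrite cD.
have : c \in (B :\: (J :\ j))%SET by rewrite Dc inE.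
rewrite !inE negb_and negbK => /andP[cJj cB].
have cj : c != j by apply: contraNneq jNB => <-.
have cNJ : c \notin J by move: cJj; rewrite (negbTE cj).
have NPc : ~~ P (w 0 c).
  apply: contra cNJ => Pc; apply: (fintype.subsetP sIJ).
  by rewrite !inE cB Pc orbT.
have := maxB J bJ; rewrite leNgt => /negP; apply.
rewrite (big_setID (J :\ j)%SET) /= (finset.setIidPr sJjB) Dc big_set1.
rewrite [ltRHS](big_setD1 j jJ) /= addrC ltrD2r.
exact: upP.
Qed.

Lemma apartment_perm (R : realType) (m : nat) (M : matroid m)
    (w : 'rV[R]_m) (B B' : {set 'I_m}) :
  is_basis M B -> is_basis M B' -> apartment R M B w -> apartment R M B' w ->
  perm_eq [seq w 0 b | b <- enum B] [seq w 0 b | b <- enum B'].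
Proof.
move=> bB bB' aB aB'.
have cE (P : pred R) : (forall x y, P x -> ~~ P y -> y < x) ->
    count P [seq w 0 b | b <- enum B] = count P [seq w 0 b | b <- enum B'].
  move=> upP; have ctE (A : {set 'I_m}) :
      count P [seq w 0 b | b <- enum A] = #|[set b in A | P (w 0 b)]%SET|.
    rewrite -sum1_count big_map -sum1_card big_enum_cond /=.
    by apply: eq_bigl => b; rewrite inE.
  by rewrite !ctE; apply/eqP; rewrite eqn_leq !(apartment_count (M := M)).
apply/seq.permP => P.
have c1 (s : seq R) t : (count_mem t s + count (fun x => (t < x)%R) s)%N =
    count (fun x => t <= x) s.
  elim: s => //= x s <-.
  by rewrite addnACA; congr (_ + _)%N; case: ltgtP.
suff pm : perm_eq [seq w 0 b | b <- enum B] [seq w 0 b | b <- enum B'].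
  by move/seq.permP: pm; apply.
rewrite /perm_eq; apply/allP => t _; apply/eqP => /=.
apply/eqP; rewrite -(eqn_add2r (count (fun x => t < x)
  [seq w 0 b | b <- enum B])) c1.
rewrite [X in _ == (_ + X)%N]cE; last first.
  by move=> x y tx; rewrite -leNgt => /le_lt_trans; apply.
rewrite c1 cE // => x y tx; rewrite -ltNge => /lt_le_trans; exact.
Qed.

Lemma elem_sym_perm (R : realType) (I : finType) (B B' : {set I})
    (x : I -> R) (i : nat) :
  perm_eq [seq x b | b <- enum B] [seq x b | b <- enum B'] ->
  elem_sym B x i = elem_sym B' x i.
Proof.
have gen (A : {set I}) :
    (\prod_(y <- [seq x b | b <- enum A]) (1 + y *: 'X)%R)`_i = elem_sym A x i.
  rewrite big_map big_enum /= big_mkcond /=.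
  rewrite (eq_bigr (fun b => (if b \in A then x b *: 'X else 0) + 1 :> {poly R}));
    last first.
    by move=> b _; case: (b \in A); rewrite ?add0r // addrC.
  rewrite bigA_distr /= coef_sum /elem_sym [RHS]big_mkcond /=.
  apply: eq_bigr => J _; rewrite -big_mkcond /=.
  case: (boolP (J \subset A)) => /= [sJA|].
    rewrite (eq_bigr (fun b => x b *: 'X)); last first.
      by move=> b bJ; rewrite (fintype.subsetP sJA).
    rewrite scaler_prod prodr_const coefZ coefXn eq_sym.
    by case: eqP; rewrite ?mulr1 ?mulr0.
  case/fintype.subsetPn => b bJ bNA.
  by rewrite (bigD1 b) //= (negbTE bNA) mul0r coef0.
by move=> pBB'; rewrite -!gen (perm_big _ pBB').
Qed.

Lemma basis_atP (R : realType) (m : nat) (M : matroid m) (w : 'rV[R]_m)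
    (B : {set 'I_m}) :
  is_basis M B -> apartment R M B w ->
  is_basis M (basis_at M w) /\ apartment R M (basis_at M w) w.
Proof.
move=> bB aB; rewrite /basis_at; case: pickP => [B' /andP[bB' /asboolP]|] //=.
by move/(_ B); rewrite bB; move/asboolP: aB => ->.
Qed.

Lemma exp_matroid_apartment (R : realType) (m : nat) (M : matroid m)
    (w : 'rV[R]_m) (B : {set 'I_m}) :
  is_basis M B -> apartment R M B w ->
  exp_matroid M w = \sum_(b in B) expR (w 0 b).
Proof.
move=> bB aB; have [bB' aB'] := basis_atP bB aB.
have : \sum_(y <- [seq w 0 b | b <- enum (basis_at M w)]) expR y =
    \sum_(y <- [seq w 0 b | b <- enum B]) expR y.
  exact: perm_big (apartment_perm bB' bB aB' aB).
by rewrite !big_map !big_enum.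
Qed.

Lemma eps_matroid_apartment (R : realType) (m : nat) (M : matroid m)
    (i : nat) (w : 'rV[R]_m) (B : {set 'I_m}) :
  is_basis M B -> apartment R M B w ->
  eps_matroid M i w = elem_sym B (fun b => w 0 b) i.
Proof.
move=> bB aB; have [bB' aB'] := basis_atP bB aB.
exact: elem_sym_perm (apartment_perm bB' bB aB' aB).
Qed.

Definition integral_pl_map (R : realType) (n : nat) (Sigma : fan R n)
    (m : nat) (M : matroid m) (Phi : 'rV[R]_n -> 'rV[R]_m) : Prop :=
  [/\ forall x, berg R M (Phi x),
      forall v : 'rV[int]_n, exists w : 'rV[int]_m, Phi (toR R v) = toR R w &
      forall sigma, cones Sigma sigma -> exists B : {set 'I_m},
        [/\ is_basis M B,
            forall x, sigma x -> apartment R M B (Phi x) &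
            exists l : {linear 'rV[R]_n -> 'rV[R]_m},
              forall x b, sigma x -> b \in B -> Phi x 0 b = l x 0 b]].

Record tropical_bundle (R : realType) (n : nat) (Sigma : fan R n) :=
  TropicalBundle {
    trop_size : nat;
    trop_matroid : matroid trop_size;
    trop_loop_free : loop_free trop_matroid;
    trop_map : 'rV[R]_n -> 'rV[R]_trop_size;
    trop_pl : integral_pl_map Sigma trop_matroid trop_map
  }.

Definition trop_K_class (R : realType) (n : nat) (Sigma : fan R n)
    (T : tropical_bundle Sigma) : 'rV[R]_n -> R :=
  fun x => exp_matroid (trop_matroid T) (trop_map T x).

Definition trop_chern_class (R : realType) (n : nat) (Sigma : fan R n)
    (T : tropical_bundle Sigma) (i : nat) : 'rV[R]_n -> R :=
  fun x => eps_matroid (trop_matroid T) i (trop_map T x).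

Record filtered_space (k : fieldType) (R : realType) (n : nat)
    (Sigma : fan R n) := FilteredSpace {
  fiber : vectType k;
  filtration : ray Sigma -> int -> {vspace fiber}
}.

(* The lines L_j and the family u, indexed by 1, ..., r, form a T-eigenline
   decomposition over U_sigma. Characters are represented by lifts of the
   classes [u j] in M_sigma to M; only their values on sigma matter. *)
Definition eigen_decomposition (k : fieldType) (R : realType) (n : nat)
    (Sigma : fan R n) (E : filtered_space k Sigma) (sigma : set 'rV[R]_n)
    (L : 'I_(\dim {: fiber E}) -> {vspace fiber E})
    (u : 'I_(\dim {: fiber E}) -> 'rV[int]_n) : Prop :=
  [/\ forall j, \dim (L j) = 1%N,
      directv (\sum_j L j)%VS,
      (\sum_j L j)%VS = fullv &
      forall rho : ray Sigma, ray_of sigma rho -> forall d : int,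
        filtration E rho d =
        (\sum_(j | (d%:~R <= pairing (toR R (u j)) (toR R (ray_gen rho)))%R)
           L j)%VS].

Definition characters (k : fieldType) (R : realType) (n : nat)
    (Sigma : fan R n) (E : filtered_space k Sigma) (sigma : set 'rV[R]_n)
    (u : 'I_(\dim {: fiber E}) -> 'rV[int]_n) : Prop :=
  exists L, eigen_decomposition sigma L u.

(* Klyachko's compatibility condition. Applied to the rays of the fan, it also
   says that each filtration is decreasing, exhaustive and separated. *)
Definition is_toric_bundle (k : fieldType) (R : realType) (n : nat)
    (Sigma : fan R n) (E : filtered_space k Sigma) : Prop :=
  forall sigma, cones Sigma sigma -> exists u, characters (E := E) sigma u.

(* Isomorphic toric vector bundles, in terms of Klyachko's equivalence. *)
Definition isomorphic (k : fieldType) (R : realType) (n : nat)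
    (Sigma : fan R n) (E E' : filtered_space k Sigma) : Prop :=
  exists f : {linear fiber E -> fiber E'}, bijective f /\
    forall rho d v, (v \in filtration E rho d) = (f v \in filtration E' rho d).

Definition is_K_class (k : fieldType) (R : realType) (n : nat)
    (Sigma : fan R n) (E : filtered_space k Sigma) (f : 'rV[R]_n -> R) : Prop :=
  forall sigma, maximal_cone Sigma sigma ->
  forall u, characters (E := E) sigma u ->
  forall x, sigma x -> f x = \sum_j expR (pairing (toR R (u j)) x).

Definition is_chern_class (k : fieldType) (R : realType) (n : nat)
    (Sigma : fan R n) (E : filtered_space k Sigma) (i : nat)
    (f : 'rV[R]_n -> R) : Prop :=
  forall sigma, maximal_cone Sigma sigma ->
  forall u, characters (E := E) sigma u ->
  forall x, sigma x ->
    f x = elem_sym [set: _]%SET (fun j => pairing (toR R (u j)) x) i.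

Lemma linear_indep0 (k : fieldType) (E : vectType k) (m : nat)
    (e : 'I_m -> E) :
  finset.set0 \in
    [set I : {set 'I_m} | free [seq e i | i <- enum I]]%SET.
Proof. by rewrite inE enum_set0 /= nil_free. Qed.

Lemma linear_indepS (k : fieldType) (E : vectType k) (m : nat)
    (e : 'I_m -> E) (I J : {set 'I_m}) :
  I \subset J ->
  J \in [set I : {set 'I_m} | free [seq e i | i <- enum I]]%SET ->
  I \in [set I : {set 'I_m} | free [seq e i | i <- enum I]]%SET.
Proof.
move=> sIJ; rewrite !inE => fJ.
have : perm_eq (enum J) (enum I ++ enum (J :\: I)%SET).
  apply: uniq_perm; rewrite ?enum_uniq ?cat_uniq ?enum_uniq ?andbT //=.
    apply/hasPn => i; rewrite !mem_enum finset.in_setD => /andP[] //.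
  move=> i; rewrite mem_cat !mem_enum finset.in_setD.
  by case: (boolP (i \in I)) => //= /(fintype.subsetP sIJ).
move/(perm_map e)/perm_free; rewrite fJ map_cat => /esym.
exact: catl_free.
Qed.

Lemma linear_augment (k : fieldType) (E : vectType k) (m : nat)
    (e : 'I_m -> E) (I J : {set 'I_m}) :
  I \in [set I : {set 'I_m} | free [seq e i | i <- enum I]]%SET ->
  J \in [set I : {set 'I_m} | free [seq e i | i <- enum I]]%SET ->
  (#|I| < #|J|)%N ->
  exists2 j, j \in (J :\: I)%SET &
    (j |: I)%SET \in [set I : {set 'I_m} | free [seq e i | i <- enum I]]%SET.
Proof.
rewrite !inE => fI fJ lt_IJ.
have [/existsP[j /andP[jJ jNI]]|] := boolP
  [exists j, (j \in J) && (e j \notin <<[seq e i | i <- enum I]>>%VS)].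
  have jI : j \notin I.
    by apply: contra jNI => jI; apply/memv_span/map_f; rewrite mem_enum.
  exists j; first by rewrite inE jI.
  rewrite inE (@perm_free _ _ _ (e j :: [seq e i | i <- enum I])).
    by rewrite free_cons jNI.
  rewrite -map_cons; apply/perm_map/uniq_perm.
  - exact: enum_uniq.
  - by rewrite /= mem_enum jI enum_uniq.
  by move=> i; rewrite mem_enum !inE mem_enum.
rewrite negb_exists => /forallP sJ.
have /dimvS : (<<[seq e i | i <- enum J]>> <= <<[seq e i | i <- enum I]>>)%VS.
  apply/span_subvP => v /mapP[j]; rewrite mem_enum => jJ ->.
  by have := sJ j; rewrite jJ /= negbK.
move: fI fJ; rewrite /free => /eqP -> /eqP ->.
by rewrite !size_map -!cardE leqNgt lt_IJ.
Qed.

Definition linear_matroid (k : fieldType) (E : vectType k) (m : nat)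
    (e : 'I_m -> E) : matroid m :=
  Matroid (linear_indep0 e) (@linear_indepS k E m e) (@linear_augment k E m e).

Lemma linear_loop_free (k : fieldType) (E : vectType k) (m : nat)
    (e : 'I_m -> E) :
  (forall i, e i != 0) -> loop_free (linear_matroid e).
Proof. by move=> e0 i; rewrite inE enum_set1 /= seq1_free. Qed.

(* The ideal L is recorded by the vectors e_i, whose linear relations
   generate it. *)
Record bundle_data (k : fieldType) (R : realType) (n : nat) (Sigma : fan R n) :=
  BundleData {
    data_space : vectType k;
    data_size : nat;
    data_vec : 'I_data_size -> data_space;
    data_vec_neq0 : forall i, data_vec i != 0;
    data_span : <<[seq data_vec i | i <- enum 'I_data_size]>>%VS = fullv;
    data_map : 'rV[R]_n -> 'rV[R]_data_size;
    data_pl : integral_pl_map Sigma (linear_matroid data_vec) data_map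
  }.

Definition bundle_of (k : fieldType) (R : realType) (n : nat)
    (Sigma : fan R n) (D : bundle_data k Sigma) : filtered_space k Sigma :=
  FilteredSpace (fun (rho : ray Sigma) (d : int) =>
    <<[seq data_vec i | i <- enum 'I_(data_size D)
        & (d%:~R <= data_map D (toR R (ray_gen rho)) 0 i)%R]>>%VS).

Definition tropicalization (k : fieldType) (R : realType) (n : nat)
    (Sigma : fan R n) (D : bundle_data k Sigma) : tropical_bundle Sigma :=
  TropicalBundle (linear_loop_free (@data_vec_neq0 _ _ _ _ D)) (data_pl D).

(* E may be presented by several data (L, Phi), each giving a tropicalization. *)
Definition is_tropicalization (k : fieldType) (R : realType) (n : nat)
    (Sigma : fan R n) (E : filtered_space k Sigma)
    (T : tropical_bundle Sigma) : Prop :=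
  exists2 D : bundle_data k Sigma,
    isomorphic E (bundle_of D) & T = tropicalization D.

(* Main.v *)
Require Import Defs.
From mathcomp Require Import all_boot all_order all_algebra.
From mathcomp Require Import all_classical all_reals all_analysis.
Set Implicit Arguments.
Unset Strict Implicit.
Unset Printing Implicit Defensive.
Import Order.TTheory GRing.Theory Num.Theory.
Local Open Scope classical_set_scope.
Local Open Scope ring_scope.

(** Fix a cone sigma of the fan and a basis B with Phi(sigma) in its apartment.
    Because B has maximal weight for w = Phi(v), a vector e_i only involves
    basis vectors e_b with w_b >= w_i ([apartment_expansion]): otherwise an
    exchange would increase the weight. Hence the steps of the filtration of a
    ray of sigma are spanned by parts of the basis (e_b), b in B, and the lines
    through the e_b decompose the bundle over U_sigma. The character on the
    line of e_b is the linear function Phi_b on sigma; it takes integral values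
    on the lattice points of sigma, so a lattice covector represents it
    ([integral_covector]). Thus for x in sigma the weights of the apartment at
    Phi(x) are the values at x of characters of the bundle, and the classes of
    the bundle and of the tropicalization, which are the same symmetric
    functions of these numbers, coincide ([data_characters]).

    It remains to see that the values of the characters do not depend on the
    decomposition into lines, nor on the bundle within its isomorphism class
    ([characters_unique]). The dimensions of the intersections of steps of the
    filtrations of the rays of sigma are invariants. They count the characters
    whose values on the ray generators satisfy given lower bounds, and these
    counts determine the multiset of value vectors on the ray generators.
    Finally, a strongly convex rational cone is generated by its rays
    ([fan_cone_rays], which rests on Gordan's theorem of the alternative), so
    the values on the rays determine the values on sigma.

    Applied to the bundle itself this yields both classes; applied to an
    isomorphic bundle presented by other data it yields the independence of the
    tropicalization. *)

(** * Pairings and cones *)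

Lemma pairingE (R : realType) (n : nat) (u x : 'rV[R]_n) :
  pairing u x = (x *m u^T) 0 0.
Proof. by rewrite mxE; apply: eq_bigr => a _; rewrite mxE mulrC. Qed.

Lemma pairingC (R : realType) (n : nat) (u x : 'rV[R]_n) :
  pairing u x = pairing x u.
Proof. by apply: eq_bigr => a _; rewrite mulrC. Qed.

Lemma pairingD (R : realType) (n : nat) (u x y : 'rV[R]_n) :
  pairing u (x + y) = pairing u x + pairing u y.
Proof. by rewrite !pairingE mulmxDl mxE. Qed.

Lemma pairingZ (R : realType) (n : nat) (c : R) (u x : 'rV[R]_n) :
  pairing u (c *: x) = c * pairing u x.
Proof. by rewrite !pairingE -scalemxAl mxE. Qed.

Lemma pairing_sum (R : realType) (n : nat) (u : 'rV[R]_n) (I : finType)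
    (P : pred I) (F : I -> 'rV[R]_n) :
  pairing u (\sum_(i | P i) F i) = \sum_(i | P i) pairing u (F i).
Proof.
rewrite pairingE mulmx_suml summxE.
by apply: eq_bigr => i _; rewrite pairingE.
Qed.

Lemma cone0 (R : realType) (n : nat) (s : seq 'rV[int]_n) : cone R s 0.
Proof. by exists (fun=> 0); split=> //; rewrite big1 // => i _; rewrite scale0r. Qed.

Lemma coneD (R : realType) (n : nat) (s : seq 'rV[int]_n) (x y : 'rV[R]_n) :
  cone R s x -> cone R s y -> cone R s (x + y).
Proof.
move=> [c [c0 ->]] [d [d0 ->]]; exists (fun i => c i + d i); split.
  by move=> i; rewrite addr_ge0.
by rewrite -big_split; apply: eq_bigr => i _; rewrite scalerDl.
Qed.

Lemma coneZ (R : realType) (n : nat) (s : seq 'rV[int]_n) (t : R)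
    (x : 'rV[R]_n) :
  0 <= t -> cone R s x -> cone R s (t *: x).
Proof.
move=> t0 [c [c0 ->]]; exists (fun i => t * c i); split.
  by move=> i; rewrite mulr_ge0.
by rewrite scaler_sumr; apply: eq_bigr => i _; rewrite scalerA.
Qed.

Lemma cone_sum (R : realType) (n : nat) (s : seq 'rV[int]_n) (I : finType)
    (P : pred I) (F : I -> 'rV[R]_n) :
  (forall i, P i -> cone R s (F i)) -> cone R s (\sum_(i | P i) F i).
Proof. by apply: big_ind; [exact: cone0 | exact: coneD]. Qed.

Lemma cone_gen (R : realType) (n : nat) (s : seq 'rV[int]_n) v :
  v \in s -> cone R s (toR R v).
Proof.
move=> vs; have lt_vs : (index v s < size s)%N by rewrite index_mem.
exists (fun i => (i == Ordinal lt_vs)%:R); split=> [i|]; first exact: ler0n.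
rewrite (bigD1 (Ordinal lt_vs)) //= eqxx scale1r nth_index // big1 ?addr0 //.
by move=> i /negbTE ->; rewrite scale0r.
Qed.

Lemma cone_sub (R : realType) (n : nat) (s t : seq 'rV[int]_n) :
  (forall v, v \in s -> cone R t (toR R v)) -> cone R s `<=` cone R t.
Proof.
move=> st x [c [c0 ->]]; apply: cone_sum => i _.
by apply: coneZ => //; apply: st; rewrite mem_nth.
Qed.

Lemma cone1P (R : realType) (n : nat) (v : 'rV[int]_n) (x : 'rV[R]_n) :
  cone R [:: v] x <-> exists2 c, 0 <= c & x = c *: toR R v.
Proof.
split=> [[c [c0 ->]]|[c c0 ->]].
  by exists (c ord0) => //; rewrite big_ord1.
by apply: coneZ => //; apply: cone_gen; rewrite mem_head.
Qed.

Lemma cone_cons (R : realType) (n : nat) (v : 'rV[int]_n) s (x : 'rV[R]_n) :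
  cone R (v :: s) x ->
  exists c (d : 'I_(size s) -> R), [/\ 0 <= c, forall i, 0 <= d i &
    x = c *: toR R v + \sum_i d i *: toR R (s`_i)].
Proof.
move=> [c [c0 ->]]; exists (c ord0), (fun i => c (lift ord0 i)).
by split=> //; rewrite big_ord_recl.
Qed.

(** * Strongly convex rational cones are generated by their rays *)

(** Gordan's theorem of the alternative, modulo a subspace W. The subspace is
    arbitrary so that induction on the number of vectors can replace W by the
    span of W and the first vector. *)
Lemma gordan (R : realType) (n p : nat) (a : 'I_p -> 'rV[R]_n) (W : 'M[R]_n) :
  (exists2 u : 'rV[R]_n, W *m u^T = 0 & forall i, 0 < pairing u (a i)) \/
  (exists c : 'I_p -> R, [/\ forall i, 0 <= c i, exists i, 0 < c i &
     ((\sum_i c i *: a i)%R <= W)%MS]).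
Proof.
elim: p a W => [|p IHp] a W.
  by left; exists 0; [rewrite trmx0 mulmx0 | case].
pose a' i := a (lift ord0 i).
have rel_cons (c0 : R) (c : 'I_p -> R) : 0 <= c0 -> (forall i, 0 <= c i) ->
    0 < c0 \/ (exists i, 0 < c i) ->
    ((c0 *: a ord0 + \sum_i c i *: a' i)%R <= W)%MS ->
    exists c : 'I_p.+1 -> R, [/\ forall i, 0 <= c i, exists i, 0 < c i &
     ((\sum_i c i *: a i)%R <= W)%MS].
  move=> c0ge cge cgt cW.
  exists (fun i => if unlift ord0 i is Some j then c j else c0); split.
  - by move=> i; case: unliftP.
  - case: cgt => [c0gt|[i ci]]; first by exists ord0; rewrite unlift_none.
    by exists (lift ord0 i); rewrite liftK.
  rewrite big_ord_recl unlift_none; apply: submx_trans cW.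
  rewrite (eq_bigr (fun i => c i *: a' i)) ?submx_refl // => i _.
  by rewrite liftK.
have [[u uW u_gt0]|[c [cge cgt cW]]] := IHp a' W; last first.
  by right; apply: (@rel_cons 0 c) => //; [right | rewrite scale0r add0r].
(* A relation modulo W and a 0 is a relation modulo W, unless it expresses a
   positive multiple of a 0 through the other vectors; u is then positive on
   a 0 as well. *)
have [[u' u'Wa u'_gt0]|[c [cge [j cj]]]] := IHp a' (W + a ord0)%MS; last first.
  case/sub_addsmxP => -[/= w t] cE.
  have tE : t *m a ord0 = t 0 0 *: a ord0.
    by rewrite {1}[t]mx11_scalar mul_scalar_mx.
  have wW : (w *m W <= W)%MS by exact: submxMl.
  have [t_gt0|t_le0] := ltrP 0 (t 0 0); last first.
    right; apply: (@rel_cons (- t 0 0) c) => //.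
    - by rewrite oppr_ge0.
    - by right; exists j.
    by rewrite cE tE scaleNr addrCA addNr addr0.
  left; exists u => // i; have [j' ->|->] := unliftP ord0 i.
    exact: u_gt0.
  have : 0 < pairing u (\sum_i c i *: a' i).
    rewrite pairing_sum (bigD1 j) //= pairingZ ltr_wpDr //.
      by apply: sumr_ge0 => k _; rewrite pairingZ mulr_ge0 // ltW.
    by rewrite mulr_gt0.
  rewrite cE tE pairingD pairingZ pairingE -mulmxA uW mulmx0 mxE add0r.
  by rewrite pmulr_rgt0.
have [a0W|a0NW] := boolP (a ord0 <= W)%MS.
  right; apply: (@rel_cons 1 (fun=> 0)) => //; first by left.
  by rewrite scale1r big1 ?addr0 // => i _; rewrite scale0r.
have [u'W u'a] : W *m u'^T = 0 /\ a ord0 *m u'^T = 0.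
  have : (W + a ord0 <= kermx u'^T)%MS by apply/sub_kermxP.
  by rewrite addsmx_sub => /andP[/sub_kermxP -> /sub_kermxP ->].
(* Now u' vanishes on a 0; it is perturbed by y, which is positive there. *)
have [y yW y_gt0] : exists2 y : 'rV[R]_n, W *m y^T = 0 & 0 < pairing y (a ord0).
  move: a0NW; rewrite submxE => /eqP/rowP/eqfunP.
  rewrite negb_forall => /existsP[j]; rewrite !mxE => nz.
  pose y := (col j (cokermx W))^T.
  have yE : pairing y (a ord0) = (a ord0 *m cokermx W) 0 j.
    by rewrite pairingE trmxK colE mulmxA -colE mxE.
  have yW : W *m y^T = 0 by rewrite trmxK colE mulmxA mulmx_coker mul0mx.
  have : pairing y (a ord0) != 0 by rewrite yE !mxE.
  rewrite neq_lt => /orP[lt0|]; last by exists y.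
  exists (- y); first by rewrite linearN /= mulmxN yW oppr0.
  by rewrite pairingC -scaleN1r pairingZ mulN1r pairingC oppr_gt0.
left.
(* K u' outweighs y on each of the other vectors. *)
pose K := 1 + \sum_i `|pairing y (a' i)| / pairing u' (a' i).
exists (K *: u' + y) => [|i].
  by rewrite linearD /= linearZ /= mulmxDr -scalemxAr u'W yW scaler0 addr0.
rewrite pairingC pairingD pairingZ ![pairing (a i) _]pairingC.
have [j ->|->] := unliftP ord0 i; last first.
  by rewrite pairingE u'a mxE mulr0 add0r.
rewrite -/(a' j) -ltrBlDr sub0r.
have u'j := u'_gt0 j.
have : `|pairing y (a' j)| < K * pairing u' (a' j).
  rewrite -ltr_pdivrMr // /K (bigD1 j) //= addrCA ltr_pwDr //.
  by rewrite ltr_pwDl // sumr_ge0 // => l _; rewrite divr_ge0 // ltW.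
by apply: le_lt_trans; rewrite -normrN ler_norm.
Qed.

Lemma primitive_generator (n : nat) (v : 'rV[int]_n) :
  v != 0 -> exists (g : nat) w, [/\ (0 < g)%N, primitive w & v = g%:Z *: w].
Proof.
move=> v0; pose P g := `[< exists w : 'rV[int]_n, v = g%:Z *: w >].
have [a va] : exists a, v 0 a != 0.
  apply/existsP; rewrite -negb_forall; apply: contra v0 => /forallP v0.
  by apply/eqP/rowP => a; rewrite mxE; apply/eqP/v0.
have exP : exists g, P g by exists 1%N; apply/asboolP; exists v; rewrite scale1r.
have leP g : P g -> (g <= `|v 0%R a|)%N.
  move=> /asboolP[w vE]; move: va; rewrite vE mxE abszM mulf_eq0 => /norP[_ wa].
  by rewrite leq_pmulr // absz_gt0.
case: (ex_maxnP exP leP) => g /asboolP[w vE] gmax.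
have gw_neq0 d (w' : 'rV[int]_n) : v = d *: w' -> d != 0.
  by move=> vE'; apply: contraNneq v0 => d0; rewrite vE' d0 scale0r.
have g_gt0 : (0 < g)%N by rewrite lt0n; exact: gw_neq0 vE.
exists g, w; split=> // d w' wE.
have : P (g * `|d|)%N.
  apply/asboolP; exists (Num.sg d *: w'); rewrite vE wE !scalerA PoszM -mulrA.
  by rewrite abszEsg mulrAC -expr2 sqr_sg; case: eqP => [->|]; rewrite ?mulr0 // mul1r.
move/gmax; rewrite -[leqRHS]muln1 leq_pmul2l // => d1.
apply/eqP; rewrite eqn_leq d1 absz_gt0 /=.
by apply: contraNneq v0 => d0; rewrite vE wE d0 scale0r scaler0.
Qed.

Lemma toRZ (R : realType) (n : nat) (d : int) (v : 'rV[int]_n) :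
  toR R (d *: v) = d%:~R *: toR R v.
Proof. by apply/rowP => a; rewrite !mxE intrM. Qed.

Lemma toR_eq0 (R : realType) (n : nat) (v : 'rV[int]_n) :
  (toR R v == 0) = (v == 0).
Proof.
apply/eqP/eqP => [/rowP v0|->]; last by apply/rowP => a; rewrite !mxE.
by apply/rowP => a; have := v0 a; rewrite !mxE => /eqP; rewrite intr_eq0 => /eqP.
Qed.

Lemma cone_primitive (R : realType) (n : nat) (g : nat) (v w : 'rV[int]_n) :
  (0 < g)%N -> v = g%:Z *: w -> cone R [:: v] = cone R [:: w].
Proof.
move=> g_gt0 vE; have gR : 0 < g%:R :> R by rewrite ltr0n.
apply/seteqP; split; apply: cone_sub => _ /[!inE] /eqP ->; apply/cone1P.
  by exists g%:R; [exact: ltW | rewrite vE toRZ].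
exists g%:R^-1; first by rewrite invr_ge0 ltW.
by rewrite vE toRZ scalerA mulVf ?scale1r // gt_eqF.
Qed.

Lemma cone_irredundant (R : realType) (n : nat) (s : seq 'rV[int]_n) :
  exists t : seq 'rV[int]_n, cone R s = cone R t /\
    forall v, v \in t -> ~ cone R (seq.rem v t) (toR R v).
Proof.
pose P N := `[< exists t : seq 'rV[int]_n, cone R s = cone R t /\ size t = N >].
have exP : exists N, P N by exists (size s); apply/asboolP; exists s.
case: (ex_minnP exP) => N /asboolP[t [tE sz_t]] minN.
exists t; split=> // v vt vc.
have : P (size t).-1.
  apply/asboolP; exists (seq.rem v t); rewrite size_rem //; split=> //.
  rewrite tE; apply/seteqP; split; apply: cone_sub => w wt; last first.
    by apply: cone_gen; exact: mem_rem wt.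
  have := perm_mem (perm_to_rem vt) w; rewrite wt inE => /esym/orP[/eqP -> //|].
  exact: cone_gen.
move/minN; rewrite -sz_t; case: (t) vt => //= ? ? _.
by rewrite ltnn.
Qed.

(** For a generator v in an irredundant list, the vectors other than v have no
    nonnegative relation modulo the line through v: a relation equal to a
    positive multiple of v would make v redundant, any other one would put a
    line in the cone. The functional given by [gordan] then cuts out the
    half-line of v as a face. *)
Lemma irredundant_extreme (R : realType) (n : nat) (t : seq 'rV[int]_n) v :
  strongly_convex (cone R t) ->
  (forall v, v \in t -> ~ cone R (seq.rem v t) (toR R v)) ->
  v \in t -> is_face (cone R [:: v]) (cone R t).
Proof.
move=> sc irr vt.
have nz w : w \in t -> toR R w != 0.
  by move=> wt; apply/eqP => w0; apply: (irr _ wt); rewrite w0; exact: cone0.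
set t' := seq.rem v t.
have tE w : (w \in t) = (w == v) || (w \in t').
  by rewrite (perm_mem (perm_to_rem vt)) inE.
have sub_t : cone R t `<=` cone R (v :: t').
  by apply: cone_sub => w; rewrite tE => wt; apply: cone_gen; rewrite inE.
have sub_t' : cone R t' `<=` cone R t.
  by apply: cone_sub => w wt; apply: cone_gen; rewrite tE wt orbT.
have [[u uv u_gt0]|[c [cge [j cj]]]] :=
    gordan (fun i : 'I_(size t') => toR R (t'`_i)) <<toR R v>>%MS.
  have uv0 : pairing u (toR R v) = 0.
    have : (toR R v <= kermx u^T)%MS.
      by rewrite -(genmxE (toR R v)); apply/sub_kermxP.
    by move/sub_kermxP; rewrite pairingE => ->; rewrite mxE.
  exists u; split=> [x /sub_t/cone_cons[c [d [c0 d0 ->]]]|].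
    rewrite pairingD pairingZ uv0 mulr0 add0r pairing_sum sumr_ge0 // => i _.
    by rewrite pairingZ mulr_ge0 // ltW.
  apply/seteqP; split=> [x /cone1P[c c0 ->]|x [/sub_t/cone_cons[c [d [c0 d0 ->]]]]].
    split; last by rewrite pairingZ uv0 mulr0.
    by apply: coneZ => //; exact: cone_gen.
  rewrite pairingD pairingZ uv0 mulr0 add0r pairing_sum => /eqP.
  rewrite psumr_eq0 => [/allP dj|i _]; last by rewrite pairingZ mulr_ge0 // ltW.
  apply/cone1P; exists c => //; rewrite big1 ?addr0 // => i _.
  have := dj i (mem_index_enum _); rewrite /= pairingZ mulf_eq0.
  by rewrite (gt_eqF (u_gt0 i)) orbF => /eqP ->; rewrite scale0r.
rewrite genmxE => /sub_rVP[b cE]; exfalso.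
have [b_gt0|b_le0] := ltrP 0 b.
  apply: (irr _ vt).
  have -> : toR R v = b^-1 *: (\sum_i c i *: toR R t'`_i).
    by rewrite cE scalerA mulVf ?scale1r // gt_eqF.
  by apply: coneZ; [rewrite invr_ge0 ltW | exists c].
have jt : t'`_j \in t by rewrite tE mem_nth ?orbT.
have := nz _ jt; rewrite (sc (toR R t'`_j)) ?eqxx //; first exact: cone_gen.
have -> : - toR R t'`_j =
    (c j)^-1 *: (- b *: toR R v + \sum_(i | i != j) c i *: toR R t'`_i).
  rewrite scaleNr -cE (bigD1 j) //= opprD addrNK scalerN scalerA mulVf ?scale1r //.
  by rewrite gt_eqF.
apply: coneZ; first by rewrite invr_ge0 ltW.
apply: coneD; first by apply: coneZ; [rewrite oppr_ge0 | exact: cone_gen].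
apply: cone_sum => i _; apply: coneZ => //; apply/sub_t'/cone_gen.
by rewrite mem_nth.
Qed.

(** Strong convexity makes the extreme rays generate, and rationality puts a
    primitive lattice vector on each of them. *)
Lemma fan_cone_rays (R : realType) (n : nat) (Sigma : fan R n)
    (sigma : set 'rV[R]_n) :
  cones Sigma sigma ->
  exists (q : nat) (rho : 'I_q -> ray Sigma),
    (forall i, ray_of sigma (rho i)) /\
    forall x, sigma x ->
      exists c : 'I_q -> R, x = \sum_i c i *: toR R (ray_gen (rho i)).
Proof.
move=> Ssigma; have [s sE] := fan_rational Ssigma.
have [t [stE irr]] := cone_irredundant R s.
have sc : strongly_convex (cone R t).
  by rewrite -stE -sE; exact: fan_strongly_convex Ssigma.
have /choice[rho rhoP] (i : 'I_(size t)) : exists rho : ray Sigma,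
    ray_of sigma rho /\ exists c, toR R t`_i = c *: toR R (ray_gen rho).
  have it : t`_i \in t by rewrite mem_nth.
  have face := irredundant_extreme sc irr it.
  have nz : t`_i != 0.
    apply/eqP => t0; apply: (irr _ it); rewrite t0.
    by have /eqP -> : toR R (0 : 'rV_n) == 0; [rewrite toR_eq0 | exact: cone0].
  have [g [w [g_gt0 prim_w tiE]]] := primitive_generator nz.
  rewrite (cone_primitive R g_gt0 tiE) -stE -sE in face.
  exists (Ray prim_w (fan_face Ssigma face)); split=> //.
  by exists g%:R; rewrite tiE toRZ.
exists (size t), rho; split=> [i|x]; first by case: (rhoP i).
rewrite sE stE => -[c [_ ->]].
have /choice[d dE] (i : 'I_(size t)) : exists c, toR R t`_i = c *: toR R (ray_gen (rho i)).
  by case: (rhoP i).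
exists (fun i => c i * d i); apply: eq_bigr => i _.
by rewrite dE scalerA.
Qed.

(** * Functions integral on the lattice points of a cone *)

Lemma toRD (R : realType) (n : nat) (v w : 'rV[int]_n) :
  toR R (v + w) = toR R v + toR R w.
Proof. exact: map_mxD. Qed.

Lemma toR_sum (R : realType) (n : nat) (I : finType) (F : I -> 'rV[int]_n) :
  toR R (\sum_i F i) = \sum_i toR R (F i).
Proof. exact: raddf_sum. Qed.

(** The covector a is integral on the lattice of the linear span of the cone:
    a point of that lattice is the difference of two lattice points of the
    cone. The Smith normal form S = P D Q of the matrix of generators exhibits
    a basis of this lattice, the rows k of Q with D k k <> 0, as part of a
    basis of the whole lattice; the integral covector is prescribed to agree
    with a on the former and to vanish on the other rows. *)
Lemma integral_covector (R : realType) (n : nat) (s : seq 'rV[int]_n)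
    (a : 'rV[R]_n) :
  (forall v, cone R s (toR R v) -> exists z : int, pairing a (toR R v) = z%:~R) ->
  exists u : 'rV[int]_n, forall x, cone R s x -> pairing (toR R u) x = pairing a x.
Proof.
move=> aZ; pose S := \matrix_(i < size s, j < n) (s`_i) 0 j.
have rowS i : row i S = s`_i by apply/rowP => j; rewrite !mxE.
have [P uP [Q uQ [d _ SE]]] := int_Smith_normal_form S.
set D := \matrix_(i, j) _ in SE.
have zP (k : 'I_n) : exists z : int, forall i : 'I_(size s), i = k :> nat ->
    d`_i != 0 -> pairing a (toR R (row k Q)) = z%:~R.
  have [[i [ik di]]|no] := pselect (exists i : 'I_(size s), i = k :> nat /\ d`_i != 0);
    last by exists 0 => i ik di; case: no; exists i.
  pose c := row i (invmx P); pose K : int := \sum_j `|c 0 j|.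
  have cE : \sum_j c 0 j *: s`_j = d`_i *: row k Q.
    have -> : \sum_j c 0 j *: s`_j = c *m S.
      by rewrite mulmx_sum_row; apply: eq_bigr => j _; rewrite rowS.
    rewrite SE mulmxA mulmxA -row_mul mulVmx // row1 -rowE.
    apply/rowP => j; rewrite !mxE (bigD1 k) //= !mxE ik eqxx mulr1n big1 ?addr0 //.
    move=> l /negbTE lk; rewrite !mxE ik.
    by rewrite eq_sym (inj_eq val_inj) lk mul0r.
  (* The coefficients of row k Q on the generators are the c j / d i, of
     absolute value at most K, so adding tot moves row k Q into the cone. *)
  pose tot := K *: \sum_(j < size s) s`_j.
  have totE : toR R tot = \sum_(j < size s) K%:~R *: toR R s`_j.
    by rewrite toRZ toR_sum scaler_sumr.
  have dR : (d`_i)%:~R != 0 :> R by rewrite intr_eq0.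
  have cK j : `|c 0 j| <= K.
    by rewrite /K (bigD1 j) //= lerDl sumr_ge0.
  have [|z1 z1E] := aZ (row k Q + tot).
    exists (fun j => (c 0 j)%:~R / (d`_i)%:~R + K%:~R); split=> [j|].
      have : `|(c 0 j)%:~R / (d`_i)%:~R| <= K%:~R :> R.
        rewrite normf_div ler_pdivrMr ?normr_gt0 // -!intr_norm -intrM ler_int.
        apply: le_trans (cK j) _; rewrite ler_peMr //; first exact: sumr_ge0.
        by rewrite -gtz0_ge1 normr_gt0.
      by rewrite ler_norml => /andP[]; rewrite -subr_ge0 opprK addrC.
    rewrite toRD totE; under [RHS]eq_bigr do rewrite scalerDl.
    rewrite big_split; congr (_ + _).
    have -> : toR R (row k Q) = (d`_i)%:~R^-1 *: toR R (d`_i *: row k Q).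
      by rewrite toRZ scalerA mulVf // scale1r.
    rewrite -cE toR_sum scaler_sumr; apply: eq_bigr => j _.
    by rewrite toRZ scalerA mulrC.
  have [|z2 z2E] := aZ tot.
    by exists (fun=> K%:~R); split=> // j; rewrite ler0z sumr_ge0.
  exists (z1 - z2) => _ _ _.
  by rewrite rmorphB /= -z1E -z2E toRD pairingD addrK.
have [z zE] := choice zP.
pose u := (invmx Q *m \col_k z k)^T; exists u.
have uE (i : 'I_(size s)) :
    pairing (toR R u) (toR R s`_i) = pairing a (toR R s`_i).
  rewrite -rowS.
  rewrite !pairingE SE -mulmxA row_mul /toR !map_mxM.
  rewrite -!mulmxA; congr ((_ *m _) 0 0).
  rewrite -map_trmx trmxK -map_mxM mulKVmx //.
  apply/colP => l; rewrite !mxE; apply: eq_bigr => k _.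
  rewrite !mxE.
  have [ik|_] := eqVneq (l : nat) k; last by rewrite !mul0r.
  have [->|dl] := eqVneq d`_l 0; first by rewrite !mul0r.
  congr (_ * _); apply: etrans (esym (zE k l ik dl)) _; rewrite pairingE mxE.
  by apply: eq_bigr => j _; rewrite !mxE.
move=> x [c [_ ->]]; rewrite !pairing_sum; apply: eq_bigr => i _.
by rewrite !pairingZ uE.
Qed.

(** * The characters read off an apartment *)

Lemma span_enum (k : fieldType) (V : vectType k) (m : nat) (e : 'I_m -> V)
    (A : {set 'I_m}) :
  <<[seq e i | i <- enum A]>>%VS = (\sum_(i in A) <[e i]>)%VS.
Proof. by rewrite span_def big_map big_enum. Qed.

Lemma free_setU1 (k : fieldType) (V : vectType k) (m : nat) (e : 'I_m -> V)
    (A : {set 'I_m}) i :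
  i \notin A -> free [seq e j | j <- enum (i |: A)%SET] =
    (e i \notin <<[seq e j | j <- enum A]>>%VS) && free [seq e j | j <- enum A].
Proof.
move=> iA; rewrite -free_cons -map_cons; apply/perm_free/perm_map/uniq_perm.
- exact: enum_uniq.
- by rewrite /= mem_enum iA enum_uniq.
by move=> j; rewrite mem_enum !inE mem_enum.
Qed.

Lemma linear_basis_span (k : fieldType) (V : vectType k) (m : nat)
    (e : 'I_m -> V) (B : {set 'I_m}) :
  <<[seq e i | i <- enum 'I_m]>>%VS = fullv -> is_basis (linear_matroid e) B ->
  basis_of fullv [seq e i | i <- enum B].
Proof.
move=> eV /maxsetP[fB maxB]; rewrite /= inE in fB.
rewrite basisEfree fB subvf /=; move: (fB); rewrite /free => /eqP <-.
apply: dimvS; rewrite -eV; apply/span_subvP => _ /mapP[i _ ->].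
apply/negPn/negP => iB.
have iNB : i \notin B.
  by apply: contra iB => iB; apply/memv_span/map_f; rewrite mem_enum.
have : (i |: B)%SET = B.
  by apply: maxB; rewrite ?finset.subsetUr //= inE free_setU1 // iB.
by move=> iBB; move: iNB; rewrite -iBB finset.setU11.
Qed.

(** Exchanging i for a vector of B that occurs in the expansion of e i gives
    another basis, so maximality of the weight of B bounds w i from above. *)
Lemma apartment_expansion (k : fieldType) (R : realType) (V : vectType k)
    (m : nat) (e : 'I_m -> V) (B : {set 'I_m}) (w : 'rV[R]_m) (i : 'I_m) :
  <<[seq e i | i <- enum 'I_m]>>%VS = fullv -> is_basis (linear_matroid e) B ->
  apartment R (linear_matroid e) B w ->
  e i \in (\sum_(b in B | (w ord0 i <= w ord0 b)%R) <[e b]>)%VS.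
Proof.
move=> eV bB [_ maxB].
have [iB|iNB] := boolP (i \in B).
  by apply: (subvP (sumv_sup i _ (subvv _))); rewrite ?iB ?lexx // memv_line.
have : e i \in (\sum_(b in B) <[e b]>)%VS.
  by rewrite -span_enum (span_basis (linear_basis_span eV bB)) memvf.
case/memv_sumP=> v vB eiE; rewrite eiE; apply: memv_suml => b bB'.
have /vlineP[c vE] := vB b bB'; rewrite vE.
have [->|c0] := eqVneq c 0; first by rewrite scale0r mem0v.
apply: memvZ.
suff le_ib : w 0 i <= w 0 b.
  by apply: (subvP (sumv_sup b _ (subvv _))); rewrite ?bB' // memv_line.
pose A := (B :\ b)%SET; pose B' := (i |: A)%SET.
have BE : B = (b |: A)%SET by rewrite finset.setD1K.
have bNA : b \notin A by rewrite finset.setD11.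
have iNA : i \notin A by rewrite inE negb_and iNB orbT.
have := basis_indep bB; rewrite [in X in X -> _]BE /= inE free_setU1 // => /andP[bA fA].
have iA : e i \notin <<[seq e j | j <- enum A]>>%VS.
  apply: contra bA => iA.
  have ebE : e b = c^-1 *: (e i - \sum_(j in A) v j).
    rewrite eiE [in X in X - _]BE big_setU1 //= vE addrK scalerA mulVf //.
    by rewrite scale1r.
  rewrite ebE memvZ // memvB // span_enum memv_sumr // => j jA.
  by apply: vB; rewrite BE inE jA orbT.
have : is_basis (linear_matroid e) B'.
  apply: (basis_card bB); first by rewrite /= inE free_setU1 // iA.
  by rewrite BE !cardsU1 bNA iNA.
by move/maxB; rewrite BE !big_setU1 //= lerD2r.
Qed.

(** The decomposition into the lines of the e b for b in B, with the characters
    given by the coordinates of the piecewise linear map. *)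
Lemma data_characters (k : fieldType) (R : realType) (n : nat)
    (Sigma : fan R n) (D : bundle_data k Sigma) (sigma : set 'rV[R]_n) :
  cones Sigma sigma ->
  exists (B : {set 'I_(data_size D)}) u,
    [/\ is_basis (linear_matroid (@data_vec _ _ _ _ D)) B,
        forall x, sigma x ->
          apartment R (linear_matroid (@data_vec _ _ _ _ D)) B (data_map D x),
        characters (E := bundle_of D) sigma u &
        forall x, sigma x ->
          perm_eq [seq data_map D x 0 b | b <- enum B]
            [seq pairing (toR R (u j)) x | j <- enum 'I_(\dim {: data_space D})]].
Proof.
move=> Ssigma; have [_ PhiZ /(_ _ Ssigma)[B [bB aB [l lE]]]] := data_pl D.
have [s sE] := fan_rational Ssigma.
have basisB := linear_basis_span (@data_span _ _ _ _ D) bB.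
have cardB : \dim {: data_space D} = #|B|.
  have := size_basis (X := in_tuple _) basisB.
  by rewrite size_map cardE.
pose beta (j : 'I_(\dim {: data_space D})) : 'I_(data_size D) :=
  enum_val (cast_ord cardB j).
have betaB j : beta j \in B by exact: enum_valP.
have beta_inj : injective beta by move=> i j /enum_val_inj/cast_ord_inj.
have beta_onto b : b \in B -> exists j, b = beta j.
  move=> bB'; exists (cast_ord (esym cardB) (enum_rank_in bB' b)).
  by rewrite /beta cast_ordKV enum_rankK_in.
have /choice[u uE] (j : 'I_(\dim {: data_space D})) : exists u : 'rV[int]_n,
    forall x, sigma x -> data_map D x 0 (beta j) = pairing (toR R u) x.
  pose a := (col (beta j) (lin1_mx l))^T.
  have aE x : sigma x -> data_map D x 0 (beta j) = pairing a x.
    move=> sx; rewrite (lE x) // pairingE trmxK colE mulmxA -colE [RHS]mxE.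
    by rewrite mul_rV_lin1.
  have [v|u uE] := @integral_covector R n s a.
    rewrite -sE => sv; rewrite -aE //; have [w ->] := PhiZ v.
    by exists (w 0 (beta j)); rewrite mxE.
  by exists u => x sx; rewrite aE // uE // -sE.
exists B, u; split=> //.
  have sum_full : (\sum_j <[data_vec (beta j)]>)%VS = fullv.
    apply/eqP; rewrite eqEsubv subvf.
    have sBV : (fullv <= <<[seq data_vec b | b <- enum B]>>)%VS.
      by rewrite (span_basis basisB).
    apply: (subv_trans sBV); apply/span_subvP => _ /mapP[b + ->]; rewrite mem_enum => /beta_onto[j ->].
    exact: (subvP (sumv_sup j _ (subvv _)) _ (memv_line _)).
  have dim1 j : \dim <[data_vec (beta j)]>%VS = 1%N.
    by rewrite dim_vline data_vec_neq0.
  exists (fun j => <[data_vec (beta j)]>%VS); split=> //.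
    rewrite directvE /= sum_full; apply/eqP.
    by under eq_bigr do rewrite dim1; rewrite sum1_card card_ord.
  move=> rho [v [_ rhoE]] d.
  have srho : sigma (toR R (ray_gen rho)).
    have : cone R [:: ray_gen rho] (toR R (ray_gen rho)).
      by apply: cone_gen; rewrite mem_head.
    by rewrite rhoE => -[].
  apply/eqP; rewrite eqEsubv; apply/andP; split.
    apply/span_subvP => _ /mapP[i + ->]; rewrite mem_filter => /andP[di _].
    apply: (subvP _ _ (apartment_expansion i (@data_span _ _ _ _ D) bB (aB _ srho))).
    apply/subv_sumP => b /andP[/beta_onto[j ->] ij].
    by apply: (sumv_sup j) => //; rewrite -uE //; exact: le_trans ij.
  apply/subv_sumP => j; rewrite -uE // => dj.
  by rewrite -memvE; apply/memv_span/map_f; rewrite mem_filter dj mem_enum.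
move=> x sx; under [X in perm_eq _ X]eq_map do rewrite -uE //.
rewrite (map_comp (fun b => data_map D x 0 b) beta).
apply/perm_map/uniq_perm; first exact: enum_uniq.
  by rewrite (map_inj_uniq beta_inj); exact: enum_uniq.
move=> b; rewrite mem_enum; apply/idP/mapP => [/beta_onto[j ->]|[j _ ->] //].
by exists j; rewrite ?mem_enum.
Qed.

(** * Uniqueness of the characters *)

Lemma directv_sub (k : fieldType) (V : vectType k) (I : finType)
    (L : I -> {vspace V}) (P : pred I) :
  directv (\sum_j L j)%VS -> directv (\sum_(j | P j) L j)%VS.
Proof.
move=> /directv_sum_independent dL; apply/directv_sum_independent => us usL us0 i Pi.
have := dL (fun j => if P j then us j else 0); rewrite -big_mkcond => /(_ _ us0 i isT).
by rewrite Pi; apply=> j _; case: ifP => [/usL|_] //; rewrite mem0v.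
Qed.

Lemma dim_sum_lines (k : fieldType) (V : vectType k) (I : finType)
    (L : I -> {vspace V}) (P : pred I) :
  (forall j, \dim (L j) = 1%N) -> directv (\sum_j L j)%VS ->
  \dim (\sum_(j | P j) L j)%VS = #|[pred j | P j]|.
Proof.
move=> L1 /(@directv_sub _ _ _ _ P)/directvP /= ->.
by under eq_bigr do rewrite L1; rewrite sum1_card.
Qed.

(** The two sides have the same dimension, by the dimension formula for the
    sum of the two subspaces and its counterpart for cardinals. *)
Lemma capv_sum_lines (k : fieldType) (V : vectType k) (I : finType)
    (L : I -> {vspace V}) (P Q : pred I) :
  (forall j, \dim (L j) = 1%N) -> directv (\sum_j L j)%VS ->
  (\sum_(j | P j) L j :&: \sum_(j | Q j) L j)%VS = (\sum_(j | P j && Q j) L j)%VS.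
Proof.
move=> L1 dL; apply/esym/eqP; rewrite eqEdim; apply/andP; split.
  by rewrite subv_cap; apply/andP; split; apply/subv_sumP => j /andP[Pj Qj];
    apply: (sumv_sup j).
have addE : (\sum_(j | P j) L j + \sum_(j | Q j) L j)%VS
    = (\sum_(j | P j || Q j) L j)%VS.
  apply/eqP; rewrite eqEsubv subv_add; apply/andP; split.
    by apply/andP; split; apply/subv_sumP => j jP; apply: (sumv_sup j);
      rewrite ?jP ?orbT.
  apply/subv_sumP => j /orP[] jP.
    by apply: subv_trans (addvSl _ _); apply: (sumv_sup j).
  by apply: subv_trans (addvSr _ _); apply: (sumv_sup j).
rewrite -(leq_add2l (\dim (\sum_(j | P j || Q j) L j))) -{1}addE dimv_sum_cap.
by rewrite !dim_sum_lines // -cardUI.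
Qed.

Definition lattice_pairing (n : nat) (u v : 'rV[int]_n) : int :=
  \sum_a u 0 a * v 0 a.

Lemma pairing_toR (R : realType) (n : nat) (u v : 'rV[int]_n) :
  pairing (toR R u) (toR R v) = (lattice_pairing u v)%:~R.
Proof.
by rewrite rmorph_sum; apply: eq_bigr => a _; rewrite !mxE rmorphM.
Qed.

(** The dimensions of the intersections of filtration steps count the
    characters by lower bounds on their values. *)
Lemma dim_cap_filtration (k : fieldType) (R : realType) (n : nat)
    (Sigma : fan R n) (E : filtered_space k Sigma) (sigma : set 'rV[R]_n)
    (u : 'I_(\dim {: fiber E}) -> 'rV[int]_n) (X : Type) (rho : X -> ray Sigma)
    (cs : seq (X * int)) :
  characters (E := E) sigma u -> (forall x, ray_of sigma (rho x)) ->
  \dim (\bigcap_(p <- cs) filtration E (rho p.1) p.2)%VS =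
    #|[pred j | all (fun p =>
        p.2 <= lattice_pairing (u j) (ray_gen (rho p.1))) cs]|.
Proof.
move=> [L [L1 dL fullL filtL]] rhoP; rewrite -(dim_sum_lines _ L1 dL).
congr (\dim _); elim: cs => [|p cs IHcs]; first by rewrite big_nil; exact: esym fullL.
rewrite big_cons IHcs filtL //.
under eq_bigl do rewrite pairing_toR ler_int.
exact: capv_sum_lines.
Qed.

Lemma memv_bigcap (k : fieldType) (V : vectType k) (X : Type) (s : seq X)
    (U : X -> {vspace V}) v :
  (v \in (\bigcap_(x <- s) U x)%VS) = all (fun x => v \in U x) s.
Proof.
by elim: s => [|x s IHs]; rewrite ?big_nil ?memvf // big_cons memv_cap IHs.
Qed.

Lemma dim_cap_filtration_isomorphic (k : fieldType) (R : realType) (n : nat)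
    (Sigma : fan R n) (E E' : filtered_space k Sigma) (X : Type)
    (rho : X -> ray Sigma) (cs : seq (X * int)) :
  isomorphic E E' ->
  \dim (\bigcap_(p <- cs) filtration E (rho p.1) p.2)%VS =
  \dim (\bigcap_(p <- cs) filtration E' (rho p.1) p.2)%VS.
Proof.
move=> [f [[g fK gK] fE]]; set U := (\bigcap_(p <- cs) filtration E _ _)%VS.
have ker0 : lker (linfun f) = 0%VS.
  by apply/eqP/lker0P => v w; rewrite !lfunE; apply: (can_inj fK).
rewrite -(@limg_dim_eq _ _ _ (linfun f) U) ?ker0 ?capv0 //.
congr (\dim _); apply/vspaceP => w; rewrite -[w]gK.
have -> : f (g w) = linfun f (g w) by rewrite lfunE.
rewrite memvE -limg_line limg_ker0 ?ker0 // -memvE lfunE !memv_bigcap.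
by apply: eq_all => p; rewrite fE.
Qed.

(** The points with x-coordinate equal to d are those with x-coordinate at
    least d minus those with x-coordinate at least d + 1, so lower bounds can
    be replaced by equations one at a time. *)
Lemma card_coords_eq (X : Type) (I I' : finType) (a : I -> X -> int)
    (a' : I' -> X -> int) :
  (forall cs : seq (X * int),
     #|[pred i | all (fun p => p.2 <= a i p.1) cs]| =
     #|[pred i | all (fun p => p.2 <= a' i p.1) cs]|) ->
  forall cs : seq (X * int),
    #|[pred i | all (fun p => a i p.1 == p.2) cs]| =
    #|[pred i | all (fun p => a' i p.1 == p.2) cs]|.
Proof.
move=> ge_eq es; pose N (J : finType) (b : J -> X -> int) cs es :=
  #|[pred i | all (fun p => p.2 <= b i p.1) cs && all (fun p => b i p.1 == p.2) es]|.
suff : forall cs, N _ a cs es = N _ a' cs es by move=> /(_ [::]).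
have split_eq (J : finType) (b : J -> X -> int) cs x d es' :
    (N _ b cs ((x, d) :: es') + N _ b ((x, (d + 1)%R) :: cs) es' =
     N _ b ((x, d) :: cs) es')%N.
  rewrite -[RHS](cardID [pred i | b i x == d]); congr (_ + _)%N; apply: eq_card => i.
    rewrite !inE /=; case: eqP => [->|_]; last by rewrite !(andbF, andbT).
    by rewrite lexx andbT.
  by rewrite !inE /= lezD1 lt_neqAle eq_sym !andbA.
elim: es => [|[x d] es IHes] cs.
  have NE (J : finType) (b : J -> X -> int) :
      N _ b cs [::] = #|[pred i | all (fun p => p.2 <= b i p.1) cs]|.
    by apply: eq_card => i; rewrite !inE andbT.
  by rewrite !NE.
by apply/eqP; rewrite -(eqn_add2r (N _ a ((x, (d + 1)%R) :: cs) es)) split_eq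
  [in X in _ == X]IHes split_eq IHes.
Qed.

Lemma perm_eq_coords (X I I' : finType) (a : I -> X -> int)
    (a' : I' -> X -> int) :
  (forall cs : seq (X * int),
     #|[pred i | all (fun p => p.2 <= a i p.1) cs]| =
     #|[pred i | all (fun p => p.2 <= a' i p.1) cs]|) ->
  perm_eq [seq finfun (a i) | i <- enum I] [seq finfun (a' i) | i <- enum I'].
Proof.
move=> /card_coords_eq eq_eq.
have countE (J : finType) (b : J -> X -> int) (t : {ffun X -> int}) :
    count_mem t [seq finfun (b i) | i <- enum J] =
    #|[pred i | all (fun p => b i p.1 == p.2) [seq (x, t x) | x <- enum X]]|.
  rewrite -sum1_count big_map -sum1_card big_enum_cond /=; apply: eq_bigl => i.
  rewrite !inE all_map; apply/eqP/allP => [<- x _|bt]; first by rewrite /= ffunE.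
  by apply/ffunP => x; rewrite ffunE; apply/eqP/bt; rewrite mem_enum.
by rewrite /perm_eq; apply/allP => t _; rewrite /= !countE eq_eq.
Qed.

(** Two isomorphic bundles are allowed: with E = E' this says that the
    characters do not depend on the decomposition into eigenlines. Points of
    sigma are combinations of the generators of its rays, so the values of
    the characters on sigma are functions of their values on rays, whose
    multiset is determined by the counts of [dim_cap_filtration]. *)
Lemma characters_unique (k : fieldType) (R : realType) (n : nat)
    (Sigma : fan R n) (E E' : filtered_space k Sigma) (sigma : set 'rV[R]_n)
    (u : 'I_(\dim {: fiber E}) -> 'rV[int]_n)
    (u' : 'I_(\dim {: fiber E'}) -> 'rV[int]_n) x :
  isomorphic E E' -> cones Sigma sigma ->
  characters (E := E) sigma u -> characters (E := E') sigma u' -> sigma x ->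
  perm_eq [seq pairing (toR R (u j)) x | j <- enum 'I_(\dim {: fiber E})]
    [seq pairing (toR R (u' j)) x | j <- enum 'I_(\dim {: fiber E'})].
Proof.
move=> isoE Ssigma uP u'P sx; have [q [rho [rhoP rho_gen]]] := fan_cone_rays Ssigma.
have [c ->] := rho_gen x sx.
pose value (t : {ffun 'I_q -> int}) : R := \sum_i c i * (t i)%:~R.
have valueE v : pairing (toR R v) (\sum_i c i *: toR R (ray_gen (rho i))) =
    value (finfun (fun i => lattice_pairing v (ray_gen (rho i)))).
  rewrite pairing_sum; apply: eq_bigr => i _.
  by rewrite pairingZ pairing_toR ffunE.
under eq_map do rewrite valueE; under [X in perm_eq _ X]eq_map do rewrite valueE.
rewrite (map_comp value (fun j => finfun _)).
rewrite [X in perm_eq _ X](map_comp value (fun j => finfun _)).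
apply/perm_map/perm_eq_coords => cs.
by rewrite -(dim_cap_filtration cs uP rhoP) -(dim_cap_filtration cs u'P rhoP);
  exact: dim_cap_filtration_isomorphic.
Qed.

(** * Comparison of the classes *)

Lemma elem_sym_imset (R : realType) (I J : finType) (f : I -> J) (B : {set I})
    (x : J -> R) (i : nat) :
  injective f -> elem_sym (f @: B)%SET x i = elem_sym B (x \o f) i.
Proof.
move=> f_inj; have preK (A : {set I}) : (f @^-1: (f @: A))%SET = A.
  by apply/finset.setP => a; rewrite inE mem_imset.
rewrite /elem_sym (reindex_onto (fun A : {set I} => f @: A)%SET
  (fun A : {set J} => f @^-1: A)%SET) /= => [|A /andP[/fintype.subsetP sAB _]].
  apply: eq_big => [A|A _]; last by rewrite big_imset //= => a b _ _; exact: f_inj.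
  by rewrite sub_imset_pre !preK card_imset // eqxx andbT.
apply/finset.setP => b; apply/imsetP/idP => [[a + ->]|bA]; first by rewrite inE.
by have /imsetP[a _ bE] := sAB b bA; exists a; rewrite // inE -bE.
Qed.

(** The two index types are embedded into their disjoint union, where
    [elem_sym_perm] applies. *)
Lemma elem_sym_perm_eq (R : realType) (I J : finType) (A : {set I})
    (B : {set J}) (x : I -> R) (y : J -> R) (i : nat) :
  perm_eq [seq x a | a <- enum A] [seq y b | b <- enum B] ->
  elem_sym A x i = elem_sym B y i.
Proof.
pose z (c : I + J) := match c with inl a => x a | inr b => y b end.
have enumE (K : finType) (f : K -> (I + J)%type) (C : {set K}) : injective f ->
    perm_eq [seq z c | c <- enum (f @: C)%SET] [seq z (f a) | a <- enum C].
  move=> f_inj; rewrite (map_comp z f); apply/perm_map/uniq_perm.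
  - exact: enum_uniq.
  - by rewrite (map_inj_uniq f_inj) enum_uniq.
  move=> c; rewrite mem_enum; apply/imsetP/mapP => -[a aC ->];
    by exists a; rewrite // ?mem_enum // -mem_enum.
have inl_inj : injective (@inl I J) by move=> ? ? [].
have inr_inj : injective (@inr I J) by move=> ? ? [].
move=> xy; have := @elem_sym_imset R _ _ inl A z i inl_inj => /esym/= ->.
have := @elem_sym_imset R _ _ inr B z i inr_inj => /esym/= ->.
apply: elem_sym_perm; apply: perm_trans (enumE _ _ _ inl_inj) _.
by rewrite perm_sym; apply: perm_trans (enumE _ _ _ inr_inj) _; rewrite perm_sym.
Qed.

(** A cone containing sigma and with the largest number of cones of the fan as
    subsets. *)
Lemma maximal_cone_above (R : realType) (n : nat) (Sigma : fan R n)
    (sigma : set 'rV[R]_n) :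
  cones Sigma sigma -> exists2 tau, maximal_cone Sigma tau & sigma `<=` tau.
Proof.
have /finite_seqP[s sE] := fan_finite Sigma.
pose below (tau : set 'rV[R]_n) := count (fun ups => `[< ups `<=` tau >]) s.
pose P N := `[< exists tau, [/\ cones Sigma tau, sigma `<=` tau & below tau = N] >].
move=> Ssigma.
have exP : exists N, P N by exists (below sigma); apply/asboolP; exists sigma; split.
have leP N : P N -> (N <= size s)%N.
  by move=> /asboolP[tau [_ _ <-]]; exact: count_size.
case: (ex_maxnP exP leP) => N /asboolP[tau [Stau st belowN]] maxN.
exists tau => //; split=> // ups Sups tu; apply/eqP/negPn/negP => tau_neq.
have nut : ~ ups `<=` tau.
  by move=> ut; move/eqP: tau_neq; apply; apply/seteqP.
have /maxN : P (below ups).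
  by apply/asboolP; exists ups; split=> //; exact: subset_trans tu.
have us : ups \in s by move: Sups; rewrite sE.
rewrite leqNgt -belowN => /negP; apply; rewrite /below.
set inT := fun v => `[< v `<=` tau >]; set inU := fun v => `[< v `<=` ups >].
rewrite -[ltnRHS]size_filter -(count_predC inT) !count_filter.
have -> : count (predI inT inU) s = count inT s.
  apply: eq_count => v /=; apply/andP/idP => [[]//|vt]; split=> //.
  by move/asboolP: vt => vt; apply/asboolP; exact: subset_trans tu.
rewrite -[ltnLHS]addn0 ltn_add2l -has_count; apply/hasP; exists ups => //=.
by apply/andP; split; apply/asboolP.
Qed.

(** The bundle E may differ from the one that the data present, so that two
    presentations of E can be compared through the characters of E. *)
Lemma trop_map_perm_characters (k : fieldType) (R : realType) (n : nat)
    (Sigma : fan R n) (E : filtered_space k Sigma) (D : bundle_data k Sigma)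
    (sigma : set 'rV[R]_n) (u : 'I_(\dim {: fiber E}) -> 'rV[int]_n) x :
  isomorphic E (bundle_of D) -> cones Sigma sigma ->
  characters (E := E) sigma u -> sigma x ->
  exists B, [/\ is_basis (linear_matroid (@data_vec _ _ _ _ D)) B,
    apartment R (linear_matroid (@data_vec _ _ _ _ D)) B (data_map D x) &
    perm_eq [seq data_map D x 0 b | b <- enum B]
      [seq pairing (toR R (u j)) x | j <- enum 'I_(\dim {: fiber E})]].
Proof.
move=> isoE Ssigma uP sx; have [B [v [bB aB vP vE]]] := data_characters D Ssigma.
exists B; split=> //; first exact: aB.
apply: perm_trans (vE x sx) _; rewrite perm_sym.
exact: (characters_unique (E' := bundle_of D) isoE Ssigma uP vP sx).
Qed.

Lemma trop_K_class_characters (k : fieldType) (R : realType) (n : nat)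
    (Sigma : fan R n) (E : filtered_space k Sigma) (D : bundle_data k Sigma)
    (sigma : set 'rV[R]_n) (u : 'I_(\dim {: fiber E}) -> 'rV[int]_n) x :
  isomorphic E (bundle_of D) -> cones Sigma sigma ->
  characters (E := E) sigma u -> sigma x ->
  trop_K_class (tropicalization D) x = \sum_j expR (pairing (toR R (u j)) x).
Proof.
move=> isoE Ssigma uP sx.
have [B [bB aB uB]] := trop_map_perm_characters isoE Ssigma uP sx.
rewrite /trop_K_class (exp_matroid_apartment bB aB).
have := perm_big (F := expR) (P := xpredT) (op := +%R) (x := 0) _ uB.
by rewrite !big_map !big_enum.
Qed.

Lemma trop_chern_class_characters (k : fieldType) (R : realType) (n : nat)
    (Sigma : fan R n) (E : filtered_space k Sigma) (D : bundle_data k Sigma)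
    (sigma : set 'rV[R]_n) (u : 'I_(\dim {: fiber E}) -> 'rV[int]_n) i x :
  isomorphic E (bundle_of D) -> cones Sigma sigma ->
  characters (E := E) sigma u -> sigma x ->
  trop_chern_class (tropicalization D) i x =
    elem_sym [set: _]%SET (fun j => pairing (toR R (u j)) x) i.
Proof.
move=> isoE Ssigma uP sx.
have [B [bB aB uB]] := trop_map_perm_characters isoE Ssigma uP sx.
rewrite /trop_chern_class (eps_matroid_apartment _ bB aB).
by apply: elem_sym_perm_eq; rewrite enum_setT -enumT.
Qed.

Lemma isomorphic_refl (k : fieldType) (R : realType) (n : nat)
    (Sigma : fan R n) (E : filtered_space k Sigma) : isomorphic E E.
Proof. by exists idfun; split=> //; exists idfun. Qed.

Theorem proposition5p4 (k : fieldType) (R : realType) (n : nat)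
    (Sigma : fan R n) (hSigma : complete_fan Sigma) (D : bundle_data k Sigma) :
  [/\ is_toric_bundle (bundle_of D),
      forall f : 'rV[R]_n -> R,
        is_K_class (bundle_of D) f <-> f = trop_K_class (tropicalization D),
      forall (i : nat) (f : 'rV[R]_n -> R),
        is_chern_class (bundle_of D) i f <->
        f = trop_chern_class (tropicalization D) i &
      forall T1 T2 : tropical_bundle Sigma,
        is_tropicalization (bundle_of D) T1 ->
        is_tropicalization (bundle_of D) T2 ->
        trop_K_class T1 = trop_K_class T2 /\
        forall i : nat, trop_chern_class T1 i = trop_chern_class T2 i].
Proof.
have refl := isomorphic_refl (bundle_of D).
have toric : is_toric_bundle (bundle_of D).
  by move=> sigma /(data_characters D)[B [u [_ _ uP _]]]; exists u.
have at_point x : exists sigma u, [/\ maximal_cone Sigma sigma, sigma x &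
    characters (E := bundle_of D) sigma u].
  have [sigma0 /maximal_cone_above[sigma maxs s0s] /s0s sx] := hSigma x.
  by have [u uP] := toric sigma (proj1 maxs); exists sigma, u.
split=> // [f|i f|T1 T2 [D1 iso1 ->] [D2 iso2 ->]].
- split=> [fK|-> sigma [Ssigma _] u uP x sx].
    apply/funext => x; have [sigma [u [maxs sx uP]]] := at_point x.
    by rewrite (fK _ maxs _ uP) // (trop_K_class_characters refl maxs.1 uP).
  exact: trop_K_class_characters refl Ssigma uP sx.
- split=> [fK|-> sigma [Ssigma _] u uP x sx].
    apply/funext => x; have [sigma [u [maxs sx uP]]] := at_point x.
    by rewrite (fK _ maxs _ uP) // (trop_chern_class_characters _ refl maxs.1 uP).
  exact: trop_chern_class_characters refl Ssigma uP sx.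
split=> [|i]; apply/funext => x; have [sigma [u [[Ssigma _] sx uP]]] := at_point x.
  by rewrite (trop_K_class_characters iso1 Ssigma uP) //
    (trop_K_class_characters iso2 Ssigma uP).
by rewrite (trop_chern_class_characters _ iso1 Ssigma uP) //
  (trop_chern_class_characters _ iso2 Ssigma uP).
Qed.
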